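(* Let $p,q\in\mathbb{R}$ with $|p|\geq|q|$ and $p\neq q$. Then a real normed linear space $X=(X,\|\cdot\|)$ is an inner product space if and only if the inequality $$\alpha_p[x,y]\geq \frac{\|x\|^{p}+\|y\|^{p}}{\|x\|^{q}+\|y\|^{q}}\,\alpha_q[x,y]$$ holds for all nonzero vectors $x,y\in X$.
   Context: For $p\in\mathbb{R}$ and nonzero vectors $x,y\in X$, the $p$-angular distance is $\alpha_p[x,y]=\big\|\,\|x\|^{p-1}x-\|y\|^{p-1}y\,\big\|$. A normed linear space is called an inner product space if its norm is induced by an inner product. *)

(* Defs.v *)
From mathcomp Require Export all_boot all_order all_algebra.
From mathcomp Require Export all_classical all_reals all_analysis.
Export numFieldNormedType.Exports.

Set Implicit Arguments.
Unset Strict Implicit.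
Unset Printing Implicit Defensive.

Local Open Scope ring_scope.

(* Only meant for nonzero x and y: [powR] with base 0 is a convention. *)
Definition angular_distance (R : realType) (X : normedModType R)
    (p : R) (x y : X) : R :=
  `| (`|x| `^ (p - 1)) *: x - (`|y| `^ (p - 1)) *: y |.

(* For the identity involution, [{dot X for idfun}] is the type of symmetric,
   positive definite bilinear forms, i.e. of real inner products on X. *)
Definition is_inner_product_space (R : realType) (X : normedModType R) : Prop :=
  exists f : {dot X for @idfun R}, forall x : X, `|x| = Num.sqrt (f x x).

(* Main.v *)
Require Import Defs.
From HB Require Import structures.
From mathcomp Require Import ring lra.

(** Write [A = |x|^p], [B = |y|^p], [C = |x|^q], [D = |y|^q].

    In an inner product space, let [c] be the cosine of the angle between [x]
    and [y].  Then [alpha_p ^ 2 = (A + B)^2 - 2 A B (1 + c)], and likewise for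
    [q], so the inequality amounts to [C D (A + B)^2 >= A B (C + D)^2].  The
    difference of the two sides is [(A C - B D) (A D - B C)], which is
    nonnegative because [p + q] and [p - q] have the same sign when
    [|q| <= |p|].

    Conversely, apply the inequality to [e^(w/p) u] and [- v] with [u], [v]
    unit vectors.  It says that [N w = |e^w u + v| / (e^w + 1)], the norm of a
    point of the chord from [v] to [u], satisfies [N (r w) <= N w] for all
    [w], where [r = q / p].  If [|r| < 1], iterating and letting [r^n] tend to
    [0] gives [N 0 <= N w].  Otherwise [r = -1], so that [N] is even, and
    convexity of the norm gives [N 0 <= N w] again.  Hence the midpoint of a
    chord of a sphere is a point of least norm on the line that carries the
    chord ([midpoint_minimal]).

    The next step is Ficken's condition: if [|u| = |v|], then
    [a = |s u + t v|] and [b = |t u + s v|] are equal ([swap_invariant]).  Put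
    [x = s u + t v], [y = t u + s v] and [P = b x + a y].  The vectors [b x]
    and [a y] have equal norms and [P] is their sum; minimality for the chord
    of [u] and [v] gives [(a + b) |x + y| <= 2 |P|], and minimality for the
    chord of [b x] and [a y] gives [(a + b) |P| <= 2 a b |x + y|].  Together
    they say [(a + b)^2 <= 4 a b], that is [a = b].

    Finally, let [g x y] be the right derivative at [t = 0] of
    [|x + t y|^2 / 2], the quantity that has to be the inner product.  In any
    normed space [g x x = |x|^2] and [g x] is sublinear.  Ficken's condition
    makes [g] symmetric, so [g] is also sublinear in its first argument, and
    this forces the left and right derivatives to coincide
    ([norm_derivativeN]).  A sublinear odd function is linear, hence [g] is
    bilinear and is the required inner product. *)

Set Implicit Arguments.
Unset Strict Implicit.
Unset Printing Implicit Defensive.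

Import Order.TTheory GRing.Theory Num.Theory.

Local Open Scope classical_set_scope.
Local Open Scope ring_scope.

(** * Auxiliary facts *)

Lemma lincomb2D (R : pzRingType) (V : lmodType R) (a b c d : R) (x y : V) :
  (a *: x + b *: y) + (c *: x + d *: y) = (a + c) *: x + (b + d) *: y.
Proof. by rewrite addrACA -!scalerDl. Qed.

Lemma scale_lincomb2 (R : pzRingType) (V : lmodType R) (k a b : R) (x y : V) :
  k *: (a *: x + b *: y) = (k * a) *: x + (k * b) *: y.
Proof. by rewrite scalerDr !scalerA. Qed.

(** To be used with error terms that are linear in a small parameter. *)
Lemma ler_add_small (R : realFieldType) (c d M : R) : 0 <= M ->
  (forall t, 0 < t -> c <= d + t * M) -> c <= d.
Proof.
move=> M0 h; apply/ler_addgt0Pr => e e0.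
have M1 : 0 < 1 + M by rewrite ltr_pwDl.
have t0 : 0 < e / (1 + M) by rewrite divr_gt0.
have := h _ t0.
have : e / (1 + M) * (1 + M) = e by rewrite divfK ?gt_eqF.
nra.
Qed.

(** * The inequality in inner product spaces *)

(** The first factor has the sign of [(p + q) (ln a - ln b)] and the second one
    that of [(p - q) (ln a - ln b)], while [(p + q) (p - q) >= 0]. *)
Lemma powR_angular_weights (R : realType) (a b p q : R) :
  0 < a -> 0 < b -> `|q| <= `|p| ->
  0 <= (a `^ p * a `^ q - b `^ p * b `^ q)
       * (a `^ p * b `^ q - b `^ p * a `^ q).
Proof.
move=> + + hpq; wlog ab : a b / ln b <= ln a.
  move=> H a0 b0; have [l|l] := leP (ln b) (ln a); first exact: H.
  by have := H b a (ltW l) b0 a0; lra.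
move=> a0 b0.
have sq : 0 <= (p + q) * (p - q).
  have : `|q| ^+ 2 <= `|p| ^+ 2 by rewrite lerXn2r.
  by rewrite !real_normK ?num_real //; lra.
rewrite -(lnK (R := R) (x := a)) ?posrE // -(lnK (R := R) (x := b)) ?posrE //.
rewrite -!expRM -!expRD.
move: (ln a) (ln b) ab => A B AB.
have [s|s] := leP 0 (p + q); have [d|d] := leP 0 (p - q).
- rewrite mulr_ge0 // subr_ge0 ler_expR; nra.
- rewrite mulr_le0 // subr_le0 ler_expR; nra.
- rewrite mulr_le0 // subr_le0 ler_expR; nra.
- rewrite mulr_le0 // subr_le0 ler_expR; nra.
Qed.

Lemma inner_product_angular_ineq (R : realType) (X : normedModType R)
    (p q : R) :
  `|q| <= `|p| -> is_inner_product_space X ->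
  forall x y : X, x <> 0 -> y <> 0 ->
     (`|x| `^ p + `|y| `^ p) / (`|x| `^ q + `|y| `^ q)
       * angular_distance q x y <= angular_distance p x y.
Proof.
move=> hpq [f fE] x y /eqP x0 /eqP y0.
have a0 : 0 < `|x| by rewrite normr_gt0.
have b0 : 0 < `|y| by rewrite normr_gt0.
have sqE z : `|z| ^+ 2 = f z z.
  rewrite fE sqr_sqrtr //.
  have [->|z0] := eqVneq z 0; first by rewrite linear0r.
  by rewrite ltW // neq0_dnorm_gt0.
have combE c d : `|c *: x - d *: y| ^+ 2 =
    c ^+ 2 * `|x| ^+ 2 + d ^+ 2 * `|y| ^+ 2 - 2 * c * d * f x y.
  have fs : f y x = f x y by rewrite (hermitian_subproof y x) expr0 mul1r.
  have fB z1 z2 z3 : f (z1 - z2) z3 = f z1 z3 - f z2 z3 by rewrite linearBl.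
  have fZ k z1 z2 : f (k *: z1) z2 = k * f z1 z2 by rewrite linearZl.
  have fBr z1 z2 z3 : f z3 (z1 - z2) = f z3 z1 - f z3 z2 by rewrite linearBr.
  have fZr k z1 z2 : f z2 (k *: z1) = k * f z2 z1 by rewrite linearZr.
  rewrite !sqE !fB !fBr !fZ !fZr fs.
  by ring.
have powB r z : 0 < z -> z `^ (r - 1) = z `^ r / z.
  by move=> z0; rewrite powRB ?powRr1 ?ltW //; rewrite lt0r_neq0 ?implybT.
have xy_ge : 0 <= `|x| * `|y| + f x y.
  have := combE 1 1; rewrite !scale1r.
  have : `|x - y| ^+ 2 <= (`|x| + `|y|) ^+ 2.
    by rewrite lerXn2r ?nnegrE ?addr_ge0 // ler_normB.
  by lra.
(* [c] is the cosine of the angle between [x] and [y] *)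
pose c := f x y / (`|x| * `|y|).
have cE : f x y = c * (`|x| * `|y|) by rewrite divfK // gt_eqF ?mulr_gt0.
have c1 : 0 <= 1 + c.
  by rewrite -(pmulr_lge0 _ (mulr_gt0 a0 b0)) mulrDl mul1r -cE.
have distE r : angular_distance r x y ^+ 2 =
    (`|x| `^ r) ^+ 2 + (`|y| `^ r) ^+ 2 - 2 * `|x| `^ r * `|y| `^ r * c.
  rewrite /angular_distance combE !powB // cE.
  by field; rewrite !gt_eqF.
have dist_ge0 r : 0 <= angular_distance r x y by exact: normr_ge0.
have C0 : 0 < `|x| `^ q by rewrite powR_gt0.
have D0 : 0 < `|y| `^ q by rewrite powR_gt0.
rewrite mulrAC ler_pdivrMr ?addr_gt0 //.
rewrite -(ler_pXn2r (ltn0Sn 1)) ?nnegrE;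
  rewrite ?mulr_ge0 ?addr_ge0 ?powR_ge0 ?dist_ge0 //.
rewrite !exprMn !distE.
have := powR_angular_weights a0 b0 hpq.
move: (`|x| `^ p) (`|y| `^ p) (`|x| `^ q) (`|y| `^ q) => A B C D W.
have : 0 <= 2 * (1 + c) * ((A * C - B * D) * (A * D - B * C)).
  by rewrite mulr_ge0 // mulr_ge0.
by lra.
Qed.

(** * From the inequality to minimality of midpoints of chords *)

(** The coefficients [a], [b] need not add up to [1]: this homogeneous form
    says that [(x + y) / 2] has least norm on the line through [x] and [y],
    and it is the form in which it is applied to arbitrary combinations. *)
Definition midpoint_minimal (R : realType) (X : normedModType R) : Prop :=
  forall x y : X, `|x| = `|y| ->
  forall a b : R, `|a + b| * `|x + y| <= 2 * `|a *: x + b *: y|.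

(** The norm of the point of the segment from [v] to [u] that has barycentric
    coordinates [e^w / (e^w + 1)] and [1 / (e^w + 1)].  With this logarithmic
    parameter, raising the ratio of the weights to the power [r] becomes
    [w |-> r w], and exchanging the weights becomes [w |-> - w]. *)
Definition chord_norm (R : realType) (X : normedModType R)
    (u v : X) (w : R) : R :=
  `|expR w *: u + v| / (expR w + 1).

Section chord_norm_theory.
Context (R : realType) (X : normedModType R).
Implicit Types (u v : X) (p q r w : R).

Lemma chord_norm0 u v : chord_norm u v 0 = `|u + v| / 2.
Proof. by rewrite /chord_norm expR0 scale1r. Qed.

Lemma chord_norm_continuous0 u v : {for 0, continuous (chord_norm u v)}.
Proof.
have ce : expR w @[w --> (0 : R)] --> expR 0 by exact: continuous_expR.
apply: cvgM.
  by apply: cvg_norm; apply: cvgD; [exact: cvgZr_tmp|exact: cvg_cst].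
apply: cvgV; first by rewrite gt_eqF // addr_gt0 ?expR_gt0.
by apply: cvgD => //; exact: cvg_cst.
Qed.

(** Iterating the hypothesis gives the bound at [r^n w], which tends to [0]. *)
Lemma chord_norm_min_contraction u v r : `|r| < 1 ->
  (forall w, chord_norm u v (r * w) <= chord_norm u v w) ->
  forall w, chord_norm u v 0 <= chord_norm u v w.
Proof.
move=> r1 h w.
have hn n : chord_norm u v (r ^+ n * w) <= chord_norm u v w.
  elim: n => [|n IH]; first by rewrite expr0 mul1r.
  by rewrite exprS -mulrA (le_trans (h _)).
have lim0 : (fun n => r ^+ n * w) @ \oo --> (0 : R).
  by rewrite -(mul0r w); apply: cvgM; [exact: cvg_expr|exact: cvg_cst].
have lim : (fun n => chord_norm u v (r ^+ n * w)) @ \oo --> chord_norm u v 0.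
  exact: (cvg_comp _ _ lim0 (@chord_norm_continuous0 u v)).
rewrite -(cvg_lim _ lim) //; apply: limr_le; last exact: nearW.
by apply/cvg_ex; eexists; exact: lim.
Qed.

(** The hypothesis makes [chord_norm u v] even, and the points of parameters
    [w] and [- w] are symmetric about the midpoint of the chord. *)
Lemma chord_norm_min_reflection u v :
  (forall w, chord_norm u v (- w) <= chord_norm u v w) ->
  forall w, chord_norm u v 0 <= chord_norm u v w.
Proof.
move=> h w; have hN : chord_norm u v (- w) = chord_norm u v w.
  by apply/eqP; rewrite eq_le h /=; have := h (- w); rewrite opprK.
suff : chord_norm u v 0 <= (chord_norm u v w + chord_norm u v (- w)) / 2 by lra.
have E0 : 0 < expR w by exact: expR_gt0.
have chordE z : chord_norm u v z =
    `|(expR z / (expR z + 1)) *: u + (expR z + 1)^-1 *: v|.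
  have z0 : 0 < expR z + 1 by rewrite addr_gt0 ?expR_gt0.
  rewrite /chord_norm mulrC -{1}[_^-1]gtr0_norm ?invr_gt0 // -normrZ scalerDr.
  by rewrite scalerA mulrC.
rewrite chord_norm0 ler_pM2r ?invr_gt0 // (chordE w) (chordE (- w)).
apply: le_trans (ler_normD _ _); rewrite lincomb2D expRN.
move: (expR w) E0 => E E0; have E10 : 0 < E + 1 by rewrite addr_gt0.
have -> : E / (E + 1) + E^-1 / (E^-1 + 1) = 1.
  by field; rewrite !gt_eqF // addrC.
have -> : (E + 1)^-1 + (E^-1 + 1)^-1 = 1.
  by field; rewrite !gt_eqF // addrC.
by rewrite !scale1r.
Qed.

(** The sign in [- v] turns the difference in the angular distance into the
    sum in [chord_norm]. *)
Lemma chord_norm_angular_distance p u v w : `|u| = 1 -> `|v| = 1 ->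
  angular_distance p (expR w *: u) (- v) = `|expR (p * w) *: u + v|.
Proof.
move=> u1 v1; rewrite /angular_distance normrN normrZ u1 v1 powR1 mulr1.
rewrite scale1r opprK gtr0_norm ?expR_gt0 // -expRM scalerA -expRD.
by congr `|expR _ *: _ + _|; ring.
Qed.

Lemma angular_ineq_chord_norm p q :
  (forall x y : X, x <> 0 -> y <> 0 ->
     (`|x| `^ p + `|y| `^ p) / (`|x| `^ q + `|y| `^ q)
       * angular_distance q x y <= angular_distance p x y) ->
  forall u v, `|u| = 1 -> `|v| = 1 ->
  forall w, chord_norm u v (q * w) <= chord_norm u v (p * w).
Proof.
move=> h u v u1 v1 w.
have u0 : u <> 0 by move=> u0; move: u1; rewrite u0 normr0; lra.
have v0 : v <> 0 by move=> v0; move: v1; rewrite v0 normr0; lra.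
have := h (expR w *: u) (- v).
rewrite !chord_norm_angular_distance // normrN normrZ u1 v1 !powR1 mulr1.
rewrite gtr0_norm ?expR_gt0 // -!expRM ![w * _]mulrC.
have p0 : 0 < expR (p * w) + 1 by rewrite addr_gt0 ?expR_gt0.
have q0 : 0 < expR (q * w) + 1 by rewrite addr_gt0 ?expR_gt0.
have eu : expR w *: u <> 0.
  by apply/eqP; rewrite scaler_eq0 negb_or gt_eqF ?expR_gt0 //; exact/eqP.
have nv : - v <> 0 by apply/eqP; rewrite oppr_eq0; exact/eqP.
move=> /(_ eu nv) {}h; rewrite /chord_norm ler_pdivlMr //.
by rewrite mulrC mulrA; rewrite mulrAC in h.
Qed.

(** The points of the chord correspond to positive coefficients, and convexity
    extends minimality from the chord to the whole line. *)
Lemma chord_norm_min_midpoint :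
  (forall u v, `|u| = 1 -> `|v| = 1 ->
    forall w, chord_norm u v 0 <= chord_norm u v w) ->
  midpoint_minimal X.
Proof.
move=> h.
have pos u v a b : `|u| = 1 -> `|v| = 1 -> 0 < a -> 0 < b ->
    (a + b) * `|u + v| <= 2 * `|a *: u + b *: v|.
  move=> u1 v1 a0 b0; have ab0 : 0 < a / b by rewrite divr_gt0.
  have := h u v u1 v1 (ln (a / b)).
  rewrite chord_norm0 /chord_norm lnK ?posrE //.
  have -> : `|(a / b) *: u + v| = `|a *: u + b *: v| / b.
    rewrite -{3}(gtr0_norm b0) -normfV [RHS]mulrC -normrZ scale_lincomb2.
    by rewrite mulVf ?gt_eqF // scale1r [a / b]mulrC.
  have -> : `|a *: u + b *: v| / b / (a / b + 1) = `|a *: u + b *: v| / (a + b).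
    by field; rewrite !gt_eqF // addr_gt0.
  by rewrite ler_pdivrMr // mulrAC ler_pdivlMr ?addr_gt0 // mulrC [2 * _]mulrC.
have on_unit u v a b : `|u| = 1 -> `|v| = 1 ->
    (a + b) * `|u + v| <= 2 * `|a *: u + b *: v|.
  (* adding [m (u + v)] makes both coefficients positive *)
  move=> u1 v1; pose m := `|a| + `|b| + 1.
  have [am bm] : 0 < m + a /\ 0 < m + b.
    have := ler_norm (- a); have := ler_norm (- b); rewrite !normrN /m.
    by have := normr_ge0 a; have := normr_ge0 b; split; lra.
  have m0 : 0 <= m by rewrite /m !addr_ge0.
  have := pos u v _ _ u1 v1 am bm; rewrite -lincomb2D -scalerDr.
  have := ler_normD (m *: (u + v)) (a *: u + b *: v).
  rewrite normrZ ger0_norm //; nra.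
move=> x y xy a b.
have [x0|x0] := eqVneq x 0.
  have y0 : y = 0 by apply/eqP; rewrite -normr_eq0 -xy x0 normr0.
  by rewrite x0 y0 addr0 normr0 mulr0 mulr_ge0.
have n0 : 0 < `|x| by rewrite normr_gt0.
have n1 : `| `|x|^-1 *: x| = 1.
  by rewrite normrZ normfV normr_id mulVf // gt_eqF.
have n2 : `| `|x|^-1 *: y| = 1.
  by rewrite normrZ normfV normr_id -xy mulVf // gt_eqF.
have n3 : `| `|x|^-1 | = `|x|^-1 by rewrite normfV normr_id.
have key c d : (c + d) * `|x + y| <= 2 * `|c *: x + d *: y|.
  have := on_unit _ _ c d n1 n2.
  rewrite -scalerDr !scalerA ![_ * `|x|^-1]mulrC -!scale_lincomb2 !normrZ n3.
  by rewrite ![_ * (`|x|^-1 * _)]mulrCA ler_pM2l ?invr_gt0.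
have [ab|ab] := leP 0 (a + b); first by rewrite ger0_norm.
rewrite ltr0_norm // opprD.
by have := key (- a) (- b); rewrite !scaleNr -(opprD (a *: x)) normrN.
Qed.

End chord_norm_theory.

(** The exponents only enter through their ratio [r = q / p], which is either of
    absolute value less than [1] or equal to [- 1]. *)
Lemma angular_ineq_midpoint_minimal (R : realType) (X : normedModType R)
    (p q : R) :
  `|q| <= `|p| -> p <> q ->
  (forall x y : X, x <> 0 -> y <> 0 ->
     (`|x| `^ p + `|y| `^ p) / (`|x| `^ q + `|y| `^ q)
       * angular_distance q x y <= angular_distance p x y) ->
  midpoint_minimal X.
Proof.
move=> hpq hne h; apply: chord_norm_min_midpoint => u v u1 v1.
have p0 : p != 0.
  apply/eqP => p0; apply: hne; apply/eqP.
  by move: hpq; rewrite p0 normr0 normr_le0 eq_sym.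
have hr w : chord_norm u v (q / p * w) <= chord_norm u v w.
  have := angular_ineq_chord_norm h u1 v1 (w / p).
  by rewrite mulrA mulrAC [p * _]mulrC divfK.
have [r1|r1] := ltP `|q / p| 1; first exact: chord_norm_min_contraction r1 hr.
have pq : `|q| = `|p|.
  apply/eqP; rewrite eq_le hpq /=; move: r1.
  by rewrite normrM normfV ler_pdivlMr ?normr_gt0 // mul1r.
have qE : q = - p.
  have /eqP := pq; rewrite eqr_norm2 => /orP[/eqP qp|/eqP//].
  by case: hne.
apply: chord_norm_min_reflection => w.
by have := hr w; rewrite qE mulNr divff // mulN1r.
Qed.

(** * Ficken's condition *)

Definition swap_invariant (R : realType) (X : normedModType R) : Prop :=
  forall x y : X, `|x| = `|y| ->
  forall s t : R, `|s *: x + t *: y| = `|t *: x + s *: y|.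

(** Minimality is used for two chords: the one of [u], [v], and the one of
    [b x], [a y], where [x], [y] are the vectors to be compared and [a], [b]
    their norms.  Since [b x + a y] is a combination of [u], [v] and [x + y],
    a multiple of [u + v], is one of [b x], [a y], each of the two norms
    [|x + y|] and [|b x + a y|] is bounded by a multiple of the other. *)
Lemma midpoint_minimal_swap (R : realType) (X : normedModType R) :
  midpoint_minimal X -> swap_invariant X.
Proof.
move=> mid u v uv s t.
set x := _ + _; set y := _ + _; pose a := `|x|; pose b := `|y|.
have a0 : 0 <= a by exact: normr_ge0.
have b0 : 0 <= b by exact: normr_ge0.
have xyE : x + y = (s + t) *: (u + v).
  by rewrite /x /y lincomb2D scalerDr [t + s]addrC.
have [xy0|xy0] := eqVneq (x + y) 0.
  rewrite -(normrN x); congr `|_|; apply/eqP.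
  by rewrite eq_sym -addr_eq0 addrC xy0.
pose P := b *: x + a *: y.
have PE : P = (b * s + a * t) *: u + (b * t + a * s) *: v.
  by rewrite /P /x /y !scale_lincomb2 lincomb2D.
have h1 : (a + b) * `|x + y| <= 2 * `|P|.
  have := mid u v uv (b * s + a * t) (b * t + a * s); rewrite -PE.
  have -> : b * s + a * t + (b * t + a * s) = (a + b) * (s + t) by ring.
  by rewrite normrM (ger0_norm (addr_ge0 a0 b0)) -mulrA -normrZ -xyE.
have h2 : (a + b) * `|P| <= 2 * (a * b) * `|x + y|.
  have nE : `|b *: x| = `|a *: y|.
    by rewrite !normrZ !ger0_norm // -/a -/b mulrC.
  have := mid _ _ nE a b; rewrite -/P !scalerA [b * a]mulrC -scalerDr normrZ.
  by rewrite !ger0_norm ?mulr_ge0 ?addr_ge0 // mulrA.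
have M0 : 0 < `|x + y| by rewrite normr_gt0.
have : (a - b) ^+ 2 * `|x + y| <= 0.
  have := ler_wpM2l (addr_ge0 a0 b0) h1; nra.
rewrite pmulr_lle0 // => ab0; rewrite -/a -/b; apply/eqP.
by rewrite -subr_eq0 -sqrf_eq0 eq_le ab0 sqr_ge0.
Qed.

(** * The one-sided derivative of half the squared norm *)

Definition norm_quotient (R : realType) (X : normedModType R)
  (x y : X) (t : R) : R := (`|x + t *: y| ^+ 2 - `|x| ^+ 2) / (2 * t).

(** By convexity the quotients decrease as [t] decreases to [0], so their
    infimum is their limit: the right derivative of [|x + t y|^2 / 2]. *)
Definition norm_derivative (R : realType) (X : normedModType R) (x y : X) : R :=
  inf [set norm_quotient x y t | t in [set t : R | 0 < t]].

Section norm_derivative_theory.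
Context (R : realType) (X : normedModType R).
Implicit Types (x y z : X) (t c : R).
Local Notation Q := (@norm_quotient R X).
Local Notation g := (@norm_derivative R X).

Lemma norm_quotientE x y t : 0 < t ->
  `|x + t *: y| ^+ 2 = `|x| ^+ 2 + 2 * t * Q x y t.
Proof. by move=> t0; rewrite /norm_quotient; field; rewrite gt_eqF. Qed.

(** By the triangle inequality [|x + t y|^2 >= |x|^2 - 2 t |x| |y|]; this makes
    the infimum of the quotients finite. *)
Lemma norm_quotient_ge x y t : 0 < t -> - (`|x| * `|y|) <= Q x y t.
Proof.
move=> t0.
have h : `|x| <= `|x + t *: y| + t * `|y|.
  have := lerB_normD x (t *: y); rewrite normrZ gtr0_norm //; lra.
rewrite /norm_quotient ler_pdivlMr ?mulr_gt0 //.
have := normr_ge0 x; have := normr_ge0 y; have := normr_ge0 (x + t *: y).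
move: h; move: `|x| `|y| `|x + t *: y| => a b A h A0 b0 a0.
have s0 : 0 <= t * b by rewrite mulr_ge0 // ltW.
suff : a ^+ 2 <= A ^+ 2 + 2 * a * (t * b) by lra.
have [ab|ba] := leP (t * b) a; last by nra.
have : 0 <= (A - (a - t * b)) * (A + (a - t * b)) by rewrite mulr_ge0 //; lra.
nra.
Qed.

Lemma has_inf_norm_quotient x y :
  has_inf [set Q x y t | t in [set t : R | 0 < t]].
Proof.
split; first by exists (Q x y 1), 1 => //=.
by exists (- (`|x| * `|y|)) => _ [t /= t0 <-]; exact: norm_quotient_ge.
Qed.

Lemma norm_derivative_le x y t : 0 < t -> g x y <= Q x y t.
Proof.
by move=> t0; apply: ge_inf; [exact: (has_inf_norm_quotient x y).2|exists t].
Qed.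

Lemma norm_derivative_ge x y c :
  (forall t, 0 < t -> c <= Q x y t) -> c <= g x y.
Proof.
move=> h; apply: lb_le_inf; first exact: (has_inf_norm_quotient x y).1.
by move=> _ [t /= t0 <-]; exact: h.
Qed.

Lemma norm_derivative_approx x y e : 0 < e ->
  exists2 t, 0 < t & Q x y t < g x y + e.
Proof.
move=> e0.
have [_ [t /= t0 <-] h] := inf_adherent e0 (has_inf_norm_quotient x y).
by exists t.
Qed.

(** The two sides differ by at least [c (1 - c) (|x| - |y|)^2]. *)
Lemma sqr_norm_convex x y c : 0 <= c <= 1 ->
  `|(1 - c) *: x + c *: y| ^+ 2 <= (1 - c) * `|x| ^+ 2 + c * `|y| ^+ 2.
Proof.
move=> /andP[c0 c1]; have d0 : 0 <= 1 - c by lra.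
have h : `|(1 - c) *: x + c *: y| <= (1 - c) * `|x| + c * `|y|.
  by rewrite (le_trans (ler_normD _ _)) // !normrZ !ger0_norm.
apply: (@le_trans _ _ (((1 - c) * `|x| + c * `|y|) ^+ 2)).
  by rewrite lerXn2r // nnegrE ?addr_ge0 ?mulr_ge0.
have : 0 <= c * (1 - c) * (`|x| - `|y|) ^+ 2.
  by rewrite mulr_ge0 ?sqr_ge0 // mulr_ge0.
nra.
Qed.

Lemma norm_quotient_mono x y s t : 0 < s -> s <= t -> Q x y s <= Q x y t.
Proof.
move=> s0 st; have t0 : 0 < t by exact: lt_le_trans st.
have c01 : 0 <= s / t <= 1.
  by rewrite ler_pdivrMr // mul1r st andbT divr_ge0 // ltW.
have := sqr_norm_convex x (x + t *: y) c01.
rewrite scalerDr addrA -scalerDl subrK scale1r scalerA divfK ?gt_eqF //.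
rewrite !norm_quotientE //.
have -> : (1 - s / t) * `|x| ^+ 2 + s / t * (`|x| ^+ 2 + 2 * t * Q x y t) =
  `|x| ^+ 2 + 2 * s * Q x y t by field; rewrite gt_eqF.
by rewrite lerD2l ler_pM2l // mulr_gt0.
Qed.

(** Convexity at the midpoint of [x + t y] and [x + t z]. *)
Lemma norm_derivativeD_le x y z : g x (y + z) <= g x y + g x z.
Proof.
apply/ler_addgt0Pr => e e0; have e20 : 0 < e / 2 by rewrite divr_gt0.
have [t1 t10 h1] := norm_derivative_approx x y e20.
have [t2 t20 h2] := norm_derivative_approx x z e20.
pose t := Num.min t1 t2.
have t0 : 0 < t by rewrite lt_min t10.
have k1 : Q x y t <= Q x y t1 by rewrite norm_quotient_mono // ge_min lexx.
have k2 : Q x z t <= Q x z t2 by rewrite norm_quotient_mono // ge_min lexx orbT.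
have u0 : 0 < t / 2 by rewrite divr_gt0.
have := norm_derivative_le x (y + z) u0.
have c01 : 0 <= (1 / 2 : R) <= 1 by apply/andP; split; lra.
have := sqr_norm_convex (x + t *: y) (x + t *: z) c01.
have -> : (1 - 1 / 2) *: (x + t *: y) + (1 / 2) *: (x + t *: z) =
          x + (t / 2) *: (y + z).
  have -> : 1 - 1 / 2 = 1 / 2 :> R by field.
  rewrite -scalerDr addrACA !scalerDr -scalerDl !scalerA -splitr scale1r.
  by rewrite div1r [t / 2]mulrC.
rewrite !norm_quotientE // => h.
have {}h : Q x (y + z) (t / 2) <= Q x y t + Q x z t.
  by rewrite -(ler_pM2l t0); lra.
lra.
Qed.

Lemma norm_derivative_id x : g x x = `|x| ^+ 2.
Proof.
have QE t : 0 < t -> Q x x t = (1 + t / 2) * `|x| ^+ 2.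
  move=> t0; rewrite /norm_quotient -{1}[x]scale1r -scalerDl normrZ.
  rewrite gtr0_norm ?addr_gt0 //.
  by field; rewrite gt_eqF.
apply/eqP; rewrite eq_le; apply/andP; split.
  have M0 : 0 <= `|x| ^+ 2 / 2 by rewrite divr_ge0 ?sqr_ge0.
  apply: (ler_add_small M0) => t t0.
  by have := norm_derivative_le x x t0; rewrite QE //; lra.
apply: norm_derivative_ge => t t0; rewrite QE //; have := sqr_ge0 `|x|; nra.
Qed.

Lemma norm_derivative0 x : g x 0 = 0.
Proof.
have QE t : Q x 0 t = 0 by rewrite /norm_quotient scaler0 addr0 subrr mul0r.
apply/eqP; rewrite eq_le; apply/andP; split.
  by rewrite -(QE 1) norm_derivative_le.
by apply: norm_derivative_ge => t _; rewrite QE.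
Qed.

Lemma norm_derivativeZ_pos x y c : 0 < c -> g x (c *: y) = c * g x y.
Proof.
have le_ y' c' : 0 < c' -> g x (c' *: y') <= c' * g x y'.
  move=> c0; rewrite mulrC -ler_pdivrMr //; apply: norm_derivative_ge => t t0.
  rewrite ler_pdivrMr //.
  rewrite (le_trans (norm_derivative_le _ _ (divr_gt0 t0 c0))) //.
  rewrite /norm_quotient scalerA divfK ?gt_eqF // le_eqVlt; apply/orP; left.
  by apply/eqP; field; rewrite !gt_eqF.
move=> c0; apply/eqP; rewrite eq_le le_ //= -ler_pdivlMl //.
have ci0 : 0 < c^-1 by rewrite invr_gt0.
by have := le_ (c *: y) _ ci0; rewrite scalerA mulVf ?gt_eqF // scale1r.
Qed.

Lemma norm_derivative0l x : g 0 x = 0.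
Proof.
have QE t : 0 < t -> Q 0 x t = t / 2 * `|x| ^+ 2.
  move=> t0; rewrite /norm_quotient add0r normrZ normr0 gtr0_norm //.
  by field; rewrite gt_eqF.
apply/eqP; rewrite eq_le; apply/andP; split; last first.
  apply: norm_derivative_ge => t t0; rewrite QE //.
  by rewrite mulr_ge0 ?sqr_ge0 ?divr_ge0 ?ltW.
have M0 : 0 <= `|x| ^+ 2 / 2 by rewrite divr_ge0 ?sqr_ge0.
apply: (ler_add_small M0) => t t0.
by have := norm_derivative_le 0 x t0; rewrite QE //; lra.
Qed.

Context (swap : swap_invariant X).

(** With [k = |y| / |x|], swapping the coefficients of the equinormed vectors
    [k x] and [y] gives [|y + t k^2 x| = k |x + t y|]. *)
Lemma norm_quotient_swap x y t : x != 0 -> y != 0 ->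
  Q x y t = Q y x (t * (`|y| / `|x|) ^+ 2).
Proof.
rewrite -(normr_eq0 x) -(normr_eq0 y) => x0 y0.
have [k k0 kE] : {k : R | 0 < k & `|y| / `|x| = k}.
  by exists (`|y| / `|x|); rewrite // divr_gt0 // lt0r ?x0 ?y0 /=.
have kx : `|y| = k * `|x| by rewrite -kE divfK.
have E : `|y + (t * k ^+ 2) *: x| = k * `|x + t *: y|.
  have kx' : `|k *: x| = `|y| by rewrite normrZ gtr0_norm.
  have := swap kx' 1 (t * k); rewrite !scale1r scalerA => E.
  rewrite -{2}(gtr0_norm k0) -normrZ scalerDr scalerA [k * t]mulrC E addrC.
  by rewrite expr2 mulrA.
rewrite /norm_quotient kE E kx !exprMn -mulrBr.
move: (_ - _) => d; have [->|t0] := eqVneq t 0.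
  by rewrite mul0r !mulr0 invr0 !mulr0.
by field; rewrite t0 gt_eqF.
Qed.

Lemma norm_derivative_sym x y : g x y = g y x.
Proof.
have [->|x0] := eqVneq x 0; first by rewrite norm_derivative0 norm_derivative0l.
have [->|y0] := eqVneq y 0; first by rewrite norm_derivative0 norm_derivative0l.
wlog suff le_ : x y x0 y0 / g x y <= g y x.
  by apply/eqP; rewrite eq_le !le_.
apply: norm_derivative_ge => t t0.
rewrite (norm_quotient_swap _ y0 x0) norm_derivative_le // mulr_gt0 //.
by rewrite exprn_gt0 // divr_gt0 ?normr_gt0.
Qed.

(** The left derivative at [x] bounds the right derivative at the earlier point
    [x - t y], since a convex function has increasing slopes; and by symmetry
    [g] is subadditive in its first argument, so the right derivative at [x]
    exceeds the one at [x - t y] by at most [t |y|^2].  Let [t] tend to [0]. *)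
Lemma norm_derivativeN x y : g x (- y) = - g x y.
Proof.
apply/eqP; rewrite eq_le; apply/andP; split; last first.
  by have := norm_derivativeD_le x y (- y); rewrite subrr norm_derivative0; lra.
suff h t : 0 < t -> g x y + g x (- y) <= t * `|y| ^+ 2.
  suff : g x y + g x (- y) <= 0 by lra.
  by apply: (ler_add_small (sqr_ge0 `|y|)) => t /h; rewrite add0r.
move=> t0.
have h1 : g x y <= g (x - t *: y) y + t * `|y| ^+ 2.
  rewrite (norm_derivative_sym x) (norm_derivative_sym _ y).
  rewrite -norm_derivative_id -norm_derivativeZ_pos //.
  by have := norm_derivativeD_le y (x - t *: y) (t *: y); rewrite subrK.
have h2 : g (x - t *: y) y <= - Q x (- y) t.
  rewrite (le_trans (norm_derivative_le _ _ t0)) // /norm_quotient subrK.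
  by rewrite scalerN -[leRHS]mulNr opprB.
have h3 := norm_derivative_le x (- y) t0.
lra.
Qed.

Lemma norm_derivativeD x y z : g x (y + z) = g x y + g x z.
Proof.
apply/eqP; rewrite eq_le norm_derivativeD_le /=.
have := norm_derivativeD_le x (- y) (- z); rewrite -opprD !norm_derivativeN.
lra.
Qed.

Lemma norm_derivativeZ x c y : g x (c *: y) = c * g x y.
Proof.
case: (ltgtP c 0) => [c0|c0|->]; last by rewrite scale0r norm_derivative0 mul0r.
- rewrite -[c *: y]opprK norm_derivativeN -scaleNr.
  by rewrite norm_derivativeZ_pos ?oppr_gt0 // mulNr opprK.
- exact: norm_derivativeZ_pos.
Qed.

Lemma swap_invariant_inner_product : is_inner_product_space X.
Proof.
have gB x : zmod_morphism (g x).
  by move=> y z; rewrite norm_derivativeD norm_derivativeN.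
have gZ x : scalable_for (idfun \; *%R) (g x).
  by move=> c y; rewrite norm_derivativeZ.
have gBl x : zmod_morphism (g ^~ x).
  by move=> y z; rewrite ![g _ x]norm_derivative_sym gB.
have gZl x : scalable_for *%R (g ^~ x).
  by move=> c y; rewrite ![g _ x]norm_derivative_sym gZ.
have gs x y : g x y = (-1) ^+ false * idfun (g y x).
  by rewrite expr0 mul1r norm_derivative_sym.
have g0 x : x != 0 -> 0 < g x x.
  by move=> x0; rewrite norm_derivative_id exprn_gt0 ?normr_gt0.
pose f : {dot X for @idfun R} := HB.pack_for {dot X for @idfun R} g
  (isBilinear.Build R X X R *%R (idfun \; *%R) g gBl gB gZl gZ)
  (isHermitianSesquilinear.Build R X false idfun g gs)
  (isDotProduct.Build R X g g0).
exists f => x; rewrite /f /= norm_derivative_id sqrtr_sqr ger0_norm //.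
Qed.

End norm_derivative_theory.

Theorem theorem5 (R : realType) (X : normedModType R) (p q : R)
    (hpq : `|q| <= `|p|) (hne : p <> q) :
  is_inner_product_space X <->
  (forall x y : X, x <> 0 -> y <> 0 ->
     angular_distance p x y >=
       (`|x| `^ p + `|y| `^ p) / (`|x| `^ q + `|y| `^ q)
         * angular_distance q x y).
Proof.
split; first exact: inner_product_angular_ineq.
move=> /(angular_ineq_midpoint_minimal hpq hne) mid.
exact/swap_invariant_inner_product/midpoint_minimal_swap.
Qed.
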